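(* If $A\subseteq\mathbb{Z}^d$ and $B\subset A$ both possess affine stratifications, then $A\setminus B$ possesses an affine stratification.
   Context: An affine semigroup is a finitely generated submonoid of $\mathbb{Z}^d$. An affine stratification of a subset $\mathcal{W}\subseteq\mathbb{Z}^d$ is a partition $\mathcal{W}=\biguplus_{i=1}^r W_i$ into finitely many pairwise disjoint sets $W_i$, each of the form $W_i=F_i+A_i$ with $F_i\subset\mathbb{Z}^d$ finite and $A_i\subset\mathbb{Z}^d$ an affine semigroup. *)

(* Defs.v *)
From mathcomp Require Import all_boot all_order all_algebra.
From mathcomp Require Import boolp classical_sets cardinality.

Set Implicit Arguments.
Unset Strict Implicit.
Unset Printing Implicit Defensive.

Import GRing.Theory.
Local Open Scope classical_set_scope.
Local Open Scope ring_scope.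

Definition submonoid (d : nat) (M : set 'rV[int]_d) : Prop :=
  GRing.nmod_closed (mem M).

(* [smallest (@submonoid d) G] is the submonoid generated by G. *)
Definition affine_semigroup (d : nat) (A : set 'rV[int]_d) : Prop :=
  exists2 G : set 'rV[int]_d, finite_set G & A = smallest (@submonoid d) G.

Definition sumset (d : nat) (F A : set 'rV[int]_d) : set 'rV[int]_d :=
  [set f + a | f in F & a in A].

(* [partition] (from classical_sets) also asks for nonempty blocks; the empty
   set is partitioned by the empty family, r = 0. *)
Definition affine_stratification (d : nat) (W : set 'rV[int]_d) (r : nat)
    (Ws : 'I_r -> set 'rV[int]_d) : Prop :=
  partition [set: 'I_r] Ws W /\
  forall i : 'I_r, exists F A : set 'rV[int]_d,
    [/\ finite_set F, affine_semigroup A & Ws i = sumset F A].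

Definition has_affine_stratification (d : nat) (W : set 'rV[int]_d) : Prop :=
  exists (r : nat) (Ws : 'I_r -> set 'rV[int]_d), affine_stratification W Ws.

(* Main.v *)
(* The sets with an affine stratification are the quantifier-free Presburger
   sets: membership of x depends only on the signs of finitely many affine forms
   at x and on x modulo some M, a description that is visibly closed under
   difference.  Conversely Presburger sets split into finitely many cells on
   which signs and residue are constant, and by Dickson's lemma each cell is
   F + A with A the monoid of lattice points of its recession cone.  That F + A
   is Presburger follows by adding one generator g at a time, i.e. eliminating
   one quantifier "exists n >= 0, x - n g in S". *)
Require Import Defs.
From mathcomp Require Import all_boot all_order all_algebra.
From mathcomp Require Import boolp classical_sets cardinality.
From mathcomp Require Import zify ring.

Set Implicit Arguments.
Unset Strict Implicit.
Unset Printing Implicit Defensive.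

Import Order.TTheory GRing.Theory Num.Theory.
Local Open Scope ring_scope.
Local Open Scope classical_set_scope.

(** Induction on [fs]. Let [N] bound [f] on a finite set that serves the tail: that set serves every
    [y] with [f y >= N], and each of the finitely many slices [f = n] with [n < N] has its own
    finite set by induction. Arbitrary functions replace coordinates so that absolute values of
    forms can be plugged in. *)
Lemma dickson (T : Type) (fs : seq (T -> nat)) (S : set T) :
  exists F : set T, [/\ finite_set F, F `<=` S &
    forall y, S y -> exists2 x, F x & all (fun f => f x <= f y)%N fs].
Proof.
elim: fs S => [|f fs IHfs] S.
  have [[x Sx]|S0] := pselect (S !=set0).
    exists [set x]; split; [exact: finite_set1 | by move=> _ ->|].
    by move=> y _; exists x.
  by exists set0; split=> // y Sy; case: S0; exists y.
have [F0 [finF0 F0S F0P]] := IHfs S.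
have [N leN] : exists N, forall x, F0 x -> (f x <= N)%N.
  have /finite_seqP[s sE] := finite_image f finF0.
  exists (\max_(i <- s) i) => x F0x.
  apply: (@leq_bigmax_seq _ s xpredT id) => //.
  have : (f @` F0) (f x) by exists x.
  by rewrite sE.
have /choice[Fs FsP] n := IHfs (S `&` [set x | f x = n]).
exists (F0 `|` \bigcup_(n in `I_N) Fs n); split.
- rewrite finite_setU; split=> //.
  by apply: bigcup_finite => [|n _]; [exact: finite_II | case: (FsP n)].
- move=> x [/F0S //|[n _]].
  by case: (FsP n) => _ FsS _ /FsS[].
move=> y Sy; have [ltyN|leNy] := ltnP (f y) N.
  have [_ FsS /(_ y)[//|x Fx xy]] := FsP (f y).
  exists x; first by right; exists (f y).
  by have [_ /= ->] := FsS x Fx; rewrite leqnn.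
have [x F0x xy] := F0P y Sy; exists x; first by left.
by rewrite /= xy (leq_trans (leN x F0x)).
Qed.

(** * Affine forms, cells and Presburger sets *)

Section Forms.
Variable d : nat.
Implicit Types (x y z g : 'rV[int]_d) (a : 'cV[int]_d) (t s : 'cV[int]_d * int).
Implicit Types (L : seq ('cV[int]_d * int)) (M : int) (S : set 'rV[int]_d).

Definition dot a x : int := (x *m a) 0 0.

Lemma dotD a x y : dot a (x + y) = dot a x + dot a y.
Proof. by rewrite /dot mulmxDl mxE. Qed.

Lemma dotB a x y : dot a (x - y) = dot a x - dot a y.
Proof. by rewrite /dot mulmxBl !mxE. Qed.

Lemma dotZ a (k : int) x : dot a (k *: x) = k * dot a x.
Proof. by rewrite /dot -scalemxAl mxE. Qed.

Lemma dot0 a : dot a 0 = 0.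
Proof. by rewrite /dot mul0mx mxE. Qed.

Lemma dotBl a b x : dot (a - b) x = dot a x - dot b x.
Proof. by rewrite /dot mulmxBr !mxE. Qed.

Lemma dotNl a x : dot (- a) x = - dot a x.
Proof. by rewrite /dot mulmxN !mxE. Qed.

Lemma dotZl a (k : int) x : dot (k *: a) x = k * dot a x.
Proof. by rewrite /dot -scalemxAr mxE. Qed.

Lemma dot_delta i x : dot (delta_mx i 0) x = x 0 i.
Proof. by rewrite /dot -colE mxE. Qed.

Definition form t x : int := dot t.1 x + t.2.

Lemma formD t x y : form t (x + y) = form t x + dot t.1 y.
Proof. by rewrite /form dotD addrAC. Qed.

Definition same_cell L M x y : Prop :=
  {in L, forall t, (0 <= form t x) = (0 <= form t y)} /\
  exists z, y = x + M *: z.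

Lemma same_cell_sym L M x y : same_cell L M x y -> same_cell L M y x.
Proof.
move=> [Lxy [z yE]]; split=> [t /Lxy //|].
by exists (- z); rewrite yE scalerN addrK.
Qed.

Lemma same_cell_sub L L' M k x y : {subset L <= L'} ->
  same_cell L' (M * k) x y -> same_cell L M x y.
Proof.
move=> LL' [L'xy [z yE]]; split=> [t /LL' /L'xy //|].
by exists (k *: z); rewrite scalerA.
Qed.

(** A semantic encoding of quantifier-free definability, with no syntax of formulas. As [same_cell]
    is symmetric, the one-way implication is full invariance, so a complement keeps the same [L] and
    [M]. *)
Definition presburger S : Prop := exists L M,
  M != 0 /\ forall x y, same_cell L M x y -> S x -> S y.

Lemma presburgerC S : presburger S -> presburger (~` S).
Proof.
move=> [L [M [M0 LS]]]; exists L, M; split=> // x y /same_cell_sym yx nSx Sy.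
exact: nSx (LS _ _ yx Sy).
Qed.

Lemma presburgerU S1 S2 :
  presburger S1 -> presburger S2 -> presburger (S1 `|` S2).
Proof.
move=> [L1 [M1 [M10 LS1]]] [L2 [M2 [M20 LS2]]].
exists (L1 ++ L2), (M1 * M2); split=> [|x y xy]; first by rewrite mulf_neq0.
case=> [/LS1 S1y|/LS2 S2y]; [left; apply: S1y|right; apply: S2y].
  by apply: same_cell_sub xy => t tL; rewrite mem_cat tL.
rewrite mulrC in xy.
by apply: same_cell_sub xy => t tL; rewrite mem_cat tL orbT.
Qed.

Lemma presburgerD S1 S2 :
  presburger S1 -> presburger S2 -> presburger (S1 `\` S2).
Proof.
move=> P1 P2; rewrite setDE -[S1 in X in presburger X]setCK -setCU.
by apply: presburgerC; apply: presburgerU => //; apply: presburgerC.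
Qed.

Lemma presburger0 : presburger set0.
Proof. by exists [::], 1. Qed.

Lemma presburger_bigcup (I : eqType) (r : seq I) (F : I -> set 'rV[int]_d) :
  {in r, forall i, presburger (F i)} ->
  presburger (\bigcup_(i in [set` r]) F i).
Proof.
elim: r => [|i r IHr] Fr.
  rewrite (_ : [set` _] = set0) ?bigcup_set0; last by apply/seteqP; split.
  exact: presburger0.
rewrite (_ : [set` _] = i |` [set` r]) ?bigcup_setU1.
  apply: presburgerU; first by apply: Fr; rewrite mem_head.
  by apply: IHr => j jr; apply: Fr; rewrite inE jr orbT.
apply/seteqP; split=> j /=; rewrite inE.
  by case/orP=> [/eqP|]; [left|right].
by case=> [->|->]; rewrite ?eqxx ?orbT.
Qed.

Lemma presburger1 v : presburger [set v].
Proof.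
(* The equation [x = v] is read off the signs of [x_i - v_i] and [v_i - x_i]; modulus 1 is
   enough. *)
pose lower i : 'cV[int]_d * int := (delta_mx i 0, - v 0 i).
pose upper i : 'cV[int]_d * int := (- delta_mx i 0, v 0 i).
exists ([seq lower i | i <- enum 'I_d] ++ [seq upper i | i <- enum 'I_d]), 1.
split=> // x y [Lxy _] xv; rewrite {}xv in Lxy.
apply/rowP => i.
have := Lxy (lower i); have := Lxy (upper i).
rewrite !mem_cat !map_f ?mem_enum ?orbT // => /(_ isT) + /(_ isT).
by rewrite /form /= !dotNl !dot_delta; lia.
Qed.

(** * Eliminating a quantifier over the multiples of a vector *)

Lemma presburger_translate v S : presburger S -> presburger [set x | S (x - v)].
Proof.
move=> [L [M [M0 LS]]].
exists [seq (t.1, t.2 - dot t.1 v) | t <- L], M; split=> // x y [Lxy [z yE]].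
apply: LS; split=> [t tL|]; last by exists z; rewrite yE addrAC.
have := Lxy _ (map_f _ tL).
by rewrite /form /= !dotB !(addrAC _ (- dot _ v)) !addrA.
Qed.

(** As [t] is not constant along [g], the value [rho] leaves at most one candidate [n], an affine
    function of [x] divided by [D]; substituting it removes the quantifier. *)
Lemma presburger_level S t g (rho : int) : presburger S -> dot t.1 g != 0 ->
  presburger [set x | exists n : nat,
    S (x - n%:Z *: g) /\ form t (x - n%:Z *: g) = rho].
Proof.
move=> [L [M [M0 LS]]]; set D := dot t.1 g => D0.
have D2 : 0 < D ^+ 2 by rewrite exprn_even_gt0.
(* D^2 s evaluated at x - n g, where n is solved from form t x - rho = D n. *)
pose pull s := (D ^+ 2 *: s.1 - (D * dot s.1 g) *: t.1,
                D ^+ 2 * s.2 - D * dot s.1 g * (t.2 - rho)).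
have pullE s x (n : int) : form t x - rho = D * n ->
    form (pull s) x = D ^+ 2 * form s (x - n *: g).
  rewrite /pull /form /= dotBl !dotZl dotB dotZ => E.
  have -> : dot t.1 x = D * n + rho - t.2 by rewrite -E; ring.
  by ring.
(* The extra form takes the value [D ^+ 2 * n], so its sign tests [0 <= n]. The factor [D] in the
   modulus makes the solution [m] for [y] an integer and keeps [y - m g] congruent to [x - n g]
   modulo [M]. *)
exists ((D *: t.1, D * (t.2 - rho)) :: [seq pull s | s <- L]), (M * D).
split=> [|x y [Lxy [z yE]] [n [Sx tx]]]; first by rewrite mulf_neq0.
have ux : form t x - rho = D * n.
  by rewrite -tx /form dotB dotZ -/D; ring.
pose m : int := n%:Z + M * dot t.1 z.
have uy : form t y - rho = D * m.
  rewrite /m yE; move: ux; rewrite /form dotD dotZ => ux.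
  by rewrite mulrDr -ux; ring.
have m0 : 0 <= m.
  have := Lxy _ (mem_head _ _).
  have E w : form (D *: t.1, D * (t.2 - rho)) w = D * (form t w - rho).
    by rewrite /form /= dotZl; ring.
  by rewrite !E ux uy !mulrA -expr2 !pmulr_rge0.
have cell : same_cell L M (x - n%:Z *: g) (y - m *: g).
  split=> [s sL|].
    have := Lxy (pull s); rewrite inE map_f ?orbT // => /(_ isT).
    by rewrite (pullE s x n) // (pullE s y m) // !pmulr_rge0.
  exists (D *: z - dot t.1 z *: g); rewrite yE /m.
  by rewrite scalerBr !scalerA scalerDl opprD addrACA addrA.
exists `|m|%N; rewrite gez0_abs //; split; first exact: LS cell Sx.
by move: uy; rewrite /form dotB dotZ -/D => uy; lia.
Qed.

(* If the least n with [x - n g] in S is at least |M|, then adding M g leaves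
   S, so some form changes sign within |M| steps of [x - n g]: up to finitely
   many choices the value of that form there, hence n, is determined by x. *)
Lemma presburger_ray S g : presburger S ->
  presburger [set x | exists n : nat, S (x - n%:Z *: g)].
Proof.
move=> PS; have [L [M [M0 LS]]] := PS.
pose level t rho := [set x | exists n : nat,
  S (x - n%:Z *: g) /\ form t (x - n%:Z *: g) = rho].
rewrite (_ : mkset _ =
  \bigcup_(j in [set` iota 0 `|M|]) [set x | S (x - j%:Z *: g)] `|`
  \bigcup_(t in [set` [seq t <- L | dot t.1 g != 0]])
    \bigcup_(k in [set` iota 0 `|M * dot t.1 g|.+1])
      (level t k%:Z `|` level t (- k%:Z))); last first.
  apply/seteqP; split=> x /=; last first.
    case=> [[j _ Sj]|[t _ [k _ [|]]]]; first by exists j.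
    - by case=> n [Sn _]; exists n.
    - by case=> n [Sn _]; exists n.
  move=> exn; have {exn} : exists n : nat, `[< S (x - n%:Z *: g) >].
    by case: exn => n Sn; exists n; apply/asboolP.
  case/ex_minnP => n /asboolP Sn minn.
  have [ltnM|leMn] := ltnP n `|M|.
    by left; exists n => //=; rewrite mem_iota.
  right; set y := x - n%:Z *: g in Sn *.
  have yE : x - (n - `|M|)%N%:Z *: g = y + `|M|%N%:Z *: g.
    by rewrite /y -subzn // scalerBl opprB addrA addrAC.
  have nSy : ~ S (y + `|M|%N%:Z *: g).
    rewrite -yE => /asboolP /minn; lia.
  have /allPn[t tL tP] :
      ~~ all (fun t => (0 <= form t y) == (0 <= form t (y + `|M|%N%:Z *: g))) L.
    apply/negP => /allP Ly; apply: nSy; apply: LS Sn; split=> [t /Ly /eqP //|].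
    exists (sgz M *: g); rewrite scalerA mulrC.
    by congr (_ + _ *: _); lia.
  move: tP; rewrite (formD t y) dotZ; set E := _%:Z * _ => tP.
  have EM : absz E = absz (M * dot t.1 g) by rewrite !abszM absz_nat.
  exists t; rewrite /= ?mem_filter ?tL ?andbT.
    by apply: contraNneq tP => g0; rewrite /E g0 mulr0 addr0.
  (* A form whose sign changes under a jump [E] has absolute value at most [|E|], with equality when
     it climbs from [-|E|] to 0; hence the [.+1]. *)
  have yM : `|form t y|%N \in iota 0 `|M * dot t.1 g|.+1.
    by rewrite mem_iota -EM; move: tP; clear; lia.
  exists `|form t y|%N => //.
  by have [f0|f0] := leP 0 (form t y); [left|right]; exists n; split=> //;
     rewrite -/y; lia.
apply: presburgerU; first by apply: presburger_bigcup => j _;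
  exact: presburger_translate.
apply: presburger_bigcup => t; rewrite mem_filter => /andP[g0 _].
apply: presburger_bigcup => k _.
by apply: presburgerU; apply: presburger_level.
Qed.

(** * Sums of Presburger sets and affine semigroups *)

Lemma submonoidE S : submonoid S <->
  S 0 /\ forall x y, S x -> S y -> S (x + y).
Proof.
rewrite /submonoid; split=> -[].
  move=> /set_mem S0 SD; split=> // x y Sx Sy.
  exact/set_mem/(SD _ _ (mem_set Sx) (mem_set Sy)).
move=> S0 SD; split; first exact: mem_set.
by move=> x y /set_mem Sx /set_mem Sy; exact/mem_set/SD.
Qed.

Lemma smallest_submonoid (G : set 'rV[int]_d) :
  submonoid (smallest (@submonoid d) G).
Proof.
apply/submonoidE; split=> [N [/submonoidE[] //]|x y Gx Gy N NG].
by have [/submonoidE[_ ND] _] := NG; apply: ND; [apply: Gx | apply: Gy].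
Qed.

Lemma presburger_sumset_semigroup S (A : set 'rV[int]_d) :
  presburger S -> affine_semigroup A -> presburger (sumset S A).
Proof.
move=> PS [G /finite_seqP[s ->] ->{A G}].
elim: s S PS => [|g s IHs] S PS.
  rewrite (_ : sumset _ _ = S) //; apply/seteqP; split=> x.
    case=> f Sf [a ga <-].
    suff -> : a = 0 by rewrite addr0.
    apply: (ga [set 0]); split=> //; apply/submonoidE; split=> // u v -> ->.
    by rewrite addr0.
  by move=> Sx; exists x => //; exists 0; rewrite ?addr0 //;
     case/submonoidE: (smallest_submonoid [set` [::]]).
(* The multiples of [g] are absorbed into [S], leaving the monoid generated by [s] for the induction
   hypothesis. *)
rewrite (_ : sumset _ _ = sumset [set x | exists n : nat, S (x - n%:Z *: g)]
                            (smallest (@submonoid d) [set` s])).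
  exact/IHs/presburger_ray.
have /submonoidE[s0 sD] := smallest_submonoid [set` s].
have /submonoidE[gs0 gsD] := smallest_submonoid [set` g :: s].
apply/seteqP; split=> x.
  case=> f Sf [a ga <-].
  have [n [b sb ->]] : exists n : nat,
      exists2 b, smallest (@submonoid d) [set` s] b & a = n%:Z *: g + b.
    (* Minimality of the generated monoid: the sums [n g + b] form a submonoid containing [g] and
       [s]. *)
    apply: (ga [set a | exists n : nat, exists2 b,
      smallest (@submonoid d) [set` s] b & a = n%:Z *: g + b]).
    split.
      apply/submonoidE; split=> [|u v].
        by exists 0%N, 0; rewrite ?scale0r ?addr0.
      move=> [n [b sb ->]] [m [c sc ->]].
      exists (n + m)%N, (b + c); first exact: sD.
      by rewrite PoszD scalerDl addrACA.
    move=> u /=; rewrite inE => /orP[/eqP->|us].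
      by exists 1%N, 0; rewrite ?scale1r ?addr0.
    by exists 0%N, u; rewrite ?scale0r ?add0r //; exact: sub_gen_smallest.
  exists (f + n%:Z *: g); last by exists b; rewrite // addrA.
  by exists n; rewrite addrK.
move=> [f [n Sn] [b sb <-]].
exists (f - n%:Z *: g) => //.
exists (n%:Z *: g + b); last by rewrite addrA subrK.
apply: (gsD); last first.
  by apply: (sub_smallest2r _ _ sb);
     [exact: smallest_submonoid | exact: (@mem_behead _ (g :: s))].
elim: n {Sn} => [|n IHn]; first by rewrite scale0r.
rewrite -[n.+1]addn1 PoszD scalerDl scale1r; apply: gsD => //.
by apply: sub_gen_smallest; exact: mem_head.
Qed.

Lemma stratification_presburger S : has_affine_stratification S -> presburger S.
Proof.
move=> [r [Ws [[<- _ _] Wi]]].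
rewrite /cover (_ : [set: 'I_r] = [set` enum 'I_r]); last first.
  by apply/seteqP; split=> i //= _; rewrite mem_enum.
apply: presburger_bigcup => i _.
have [F [A [/finite_seqP[s ->] Aaff ->]]] := Wi i.
apply: presburger_sumset_semigroup => //.
rewrite (_ : [set` s] = \bigcup_(v in [set` s]) [set v]).
  by apply: presburger_bigcup => v _; exact: presburger1.
by apply/seteqP; split=> [v vs|v [w ws ->] //]; exists v.
Qed.

(** * From cells back to affine stratifications *)

Lemma affine_semigroup_cone (L : seq 'cV[int]_d) M :
  affine_semigroup [set y | (exists z, y = M *: z) /\
                            {in L, forall a, 0 <= dot a y}].
Proof.
set C := mkset _.
(* Monotonicity of both parts forces |y - x| = |y| - |x| coordinatewise, which
   makes the descent y |-> y - x terminate. *)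
pose pos i (y : 'rV[int]_d) : nat := if y 0 i is Posz n then n else 0%N.
pose neg i (y : 'rV[int]_d) : nat := if y 0 i is Negz n then n.+1 else 0%N.
(* Gordan's argument: a finite Dickson set of nonzero points of [C] generates [C]. If [x] in [F]
   lies below [y], then [y - x] is again in [C], because [0 <= dot a x <= dot a y]. *)
have [F [finF FC FP]] := dickson ([seq (fun y => `|dot a y|%N) | a <- L] ++
  [seq pos i | i <- enum 'I_d] ++ [seq neg i | i <- enum 'I_d]) (C `\ 0).
exists F => //; apply/seteqP; split; last first.
  apply: smallest_sub => [|x /FC[]//].
  apply/submonoidE; split.
    by split=> [|a _]; [exists 0; rewrite scaler0 | rewrite dot0].
  move=> x y [[z ->] Lx] [[w ->] Ly]; split.
    by exists (z + w); rewrite scalerDr.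
  by move=> a aL; rewrite dotD addr_ge0 ?Lx ?Ly.
have /submonoidE[G0 GD] := smallest_submonoid F.
move=> y Cy; have [n] := ubnP (\sum_i absz (y 0%R i))%N.
elim: n y Cy => // n IHn y Cy ltyn.
have [->//|/eqP y0] := eqVneq y 0.
have [x Fx] := FP y (conj Cy y0).
rewrite !all_cat !all_map => /and3P[/allP/= Lxy /allP pxy /allP nxy].
have [[[z xE] Lx] /= x0] := FC x Fx.
have [[w yE] Ly] := Cy.
rewrite -(subrK x y) addrC; apply: GD; first exact: sub_gen_smallest.
have normE i : (absz ((y - x)%R 0%R i) + absz (x 0%R i))%N = absz (y 0 i).
  have i_enum : i \in Finite.enum 'I_d by rewrite -enumT mem_enum.
  have /= := pxy i i_enum; have /= := nxy i i_enum.
  by rewrite /pos /neg !mxE; case: (x 0 i) => p; case: (y 0 i) => q /=; lia.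
apply: IHn.
  split=> [|a aL]; first by exists (w - z); rewrite scalerBr -xE -yE.
  by have := Lxy a aL; have := Lx a aL; have := Ly a aL; rewrite dotB; lia.
rewrite -ltnS; apply: leq_trans ltyn; rewrite ltnS.
under [X in (_ < X)%N]eq_bigr => i _ do rewrite -normE.
rewrite big_split /= -[X in (X < _)%N]addn0 ltn_add2l lt0n.
apply: contra_notN x0; rewrite sum_nat_eq0 => /forallP /= x0.
by apply/rowP => i; have := x0 i; rewrite mxE; lia.
Qed.

Lemma same_cell_sumset L M x0 : exists F A : set 'rV[int]_d,
  [/\ finite_set F, affine_semigroup A & same_cell L M x0 = sumset F A].
Proof.
(* Forms negative at [x0] are flipped, so that moving along the cone of [K] never brings a form
   closer to a sign change. Conversely, if [x] is below [y] in the Dickson order on absolute values,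
   [y - x] lies in that cone. *)
pose K := [seq (if 0 <= form t x0 then t.1 else - t.1) | t <- L].
have [F [finF FC FP]] :=
  dickson [seq (fun y => `|form t y|%N) | t <- L] (same_cell L M x0).
exists F, [set y | (exists z, y = M *: z) /\ {in K, forall a, 0 <= dot a y}].
split=> //; first exact: affine_semigroup_cone.
apply/seteqP; split=> y.
  move=> x0y; have [x Fx] := FP y x0y; rewrite all_map => /allP /= xy.
  exists x => //; exists (y - x); last by rewrite addrC subrK.
  have [Lx [z xE]] := FC x Fx; have [Ly [w yE]] := x0y.
  split.
    by exists (w - z); rewrite scalerBr xE yE opprD addrACA subrr add0r.
  move=> _ /mapP[t tL ->].
  have := xy t tL; have := Lx t tL; have := Ly t tL.
  have -> : form t y = form t x + dot t.1 (y - x) by rewrite -formD addrC subrK.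
  by case: leP => _; rewrite ?dotNl; move: (form t x) (dot _ _) => u v; lia.
move=> [x Fx [a [[z ->] Ka] <-]].
have [Lx [w xE]] := FC x Fx; split; last first.
  by exists (w + z); rewrite xE -addrA scalerDr.
move=> t tL; have := Ka _ (map_f _ tL); have := Lx t tL.
rewrite formD.
by case: leP => _; rewrite ?dotNl; move: (form t x) (dot _ _) => u v; lia.
Qed.

Lemma same_cell_finite L M : M != 0 ->
  exists (K : finType) (key : 'rV[int]_d -> K),
    forall x y, same_cell L M x y <-> key x = key y.
Proof.
move=> M0.
(* Sign vector and residue vector. The type ['I_(|M|.-1.+1)] is visibly inhabited, as [inord]
   requires, and since [M != 0] it has room for every residue, so [inord] loses nothing. *)
pose key x := ([ffun t : seq_sub L => 0 <= form (val t) x],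
  [ffun i : 'I_d => inord `|(x 0%R i %% M)%Z|%N : 'I_`|M|%N.-1.+1]).
exists _, key => x y; split=> [[Lxy [z yE]]|[/ffunP sxy /ffunP mxy]].
  congr (_, _); apply/ffunP => i; rewrite !ffunE; first exact/Lxy/valP.
  by rewrite yE !mxE addrC mulrC modzMDl.
split=> [t tL|]; first by have := sxy (SeqSub tL); rewrite !ffunE.
exists (\row_i ((y 0%R i %/ M)%Z - (x 0%R i %/ M)%Z)).
apply/rowP => i; rewrite !mxE.
have modE : (y 0%R i %% M)%Z = (x 0%R i %% M)%Z.
  have := mxy i; rewrite !ffunE => /(congr1 val); rewrite /= !inordK.
  - have := modz_ge0 (x 0 i) M0; have := modz_ge0 (y 0 i) M0; lia.
  - have := modz_ge0 (y 0 i) M0; have := ltz_mod (y 0 i) M0; lia.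
  - have := modz_ge0 (x 0 i) M0; have := ltz_mod (x 0 i) M0; lia.
by rewrite {1}(divz_eq (y 0 i) M) {1}(divz_eq (x 0 i) M) modE; ring.
Qed.

Lemma presburger_stratification S : presburger S -> has_affine_stratification S.
Proof.
move=> [L [M [M0 LS]]]; have [K [key keyP]] := same_cell_finite L M0.
(* Only keys attained on [S] index blocks: this makes every block nonempty, and invariance of [S]
   keeps each block inside [S]. *)
pose P := [set k | `[< exists2 x, S x & key x = k >]]%SET.
have /choice[rep repP] (i : 'I_#|P|) : exists x, S x /\ key x = enum_val i.
  by have := enum_valP i; rewrite inE => /asboolP[x Sx kx]; exists x.
exists #|P|, (fun i => same_cell L M (rep i)); split;
  last by move=> i; exact: same_cell_sumset.
split.
- apply/seteqP; split=> [x [i _ ix]|x Sx]; first exact: LS ix (repP i).1.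
  have kP : key x \in P by rewrite inE; apply/asboolP; exists x.
  exists (enum_rank_in kP (key x)) => //.
  by apply/keyP; rewrite (repP _).2 enum_rankK_in.
- move=> i j _ _ [x [/keyP ix /keyP jx]]; apply: enum_val_inj.
  by rewrite -(repP i).2 -(repP j).2 ix jx.
- by move=> i _; exists (rep i); apply/keyP.
Qed.

End Forms.

Theorem theorem4p2 (d : nat) (A B : set 'rV[int]_d) (BA : B `<=` A)
    (hA : has_affine_stratification A) (hB : has_affine_stratification B) :
  has_affine_stratification (A `\` B).
Proof.
apply: presburger_stratification.
by apply: presburgerD; exact: stratification_presburger.
Qed.
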